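(* As $n\to\infty$, \[ \log N(n)=\log A_{\rm adm}(n)+o\!\left(\frac{n}{\log n}\right). \]
   Context: For an integer $n\ge 1$ let $X_n=\{2,3,\ldots,n+1\}$. A truncated residue profile of length $n$ is a tuple $r=(r_2,\ldots,r_n)$ with $r_k\in\mathbb Z/k\mathbb Z$ for each $2\le k\le n$ (the empty tuple if $n=1$). Its survivor set is \[ S_n(r)=\{m\in X_n:\ m\not\equiv r_k\pmod k\text{ for every } 2\le k<m\}. \] Let $\mathcal F_n=\{S_n(r): r \text{ a truncated profile of length } n\}$ and $N(n)=|\mathcal F_n|$ (the number of distinct survivor sets). A set $A\subseteq X_n$ is prime-admissible if for every prime $p$ the set $A$ omits at least one residue class modulo $p$, i.e. the image of $A$ in $\mathbb Z/p\mathbb Z$ is not all of $\mathbb Z/p\mathbb Z$. $A_{\rm adm}(n)$ denotes the number of prime-admissible subsets of $X_n$. *)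

(* Defs.v *)
From mathcomp Require Import all_boot all_order all_algebra.
From mathcomp Require Import boolp.

Set Implicit Arguments.
Unset Strict Implicit.
Unset Printing Implicit Defensive.

Import GRing.Theory.
Local Open Scope ring_scope.

(* The set {2, ..., n+1}, inside the type of naturals at most n+1. *)
Definition X_set (n : nat) : {set 'I_n.+2} := [set m : 'I_n.+2 | (2 <= m)%N].

(* The index j < n-1 stands for the modulus k = j + 2, so that 2 <= k <= n;
   for n = 1 the only profile is the empty one. *)
Notation profile n := {dffun forall j : 'I_n.-1, 'Z_(j.+2)}.

(* The test below compares m and r_k in Z/kZ, with k = j + 2. *)
Definition survivors (n : nat) (r : profile n) : {set 'I_n.+2} :=
  [set m : 'I_n.+2 in X_set n |
    [forall j : 'I_n.-1, (j.+2 < m)%N ==> ((m : nat)%:R != r j)]].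

Definition survivor_family (n : nat) : {set {set 'I_n.+2}} :=
  [set survivors r | r : profile n].

Definition N_surv (n : nat) : nat := #|survivor_family n|.

Definition prime_admissible (n : nat) (A : {set 'I_n.+2}) : Prop :=
  forall p : nat, prime p ->
    [set ((m : nat)%:R : 'Z_p) | m : 'I_n.+2 in A] != [set: 'Z_p].

Definition A_adm (n : nat) : nat :=
  #|[set A : {set 'I_n.+2} | (A \subset X_set n) && `[< prime_admissible A >]]|.

(* Main.v *)
Require Import Defs.
From mathcomp Require Import all_boot all_order all_algebra.
From mathcomp Require Import all_classical all_reals all_analysis.
(* Imported again, so that the names about finite sets take precedence over
   those about classical sets. *)
From mathcomp Require Import all_boot all_order all_algebra cyclic.
From mathcomp Require Import ring lra zify.
Set Implicit Arguments.
Unset Strict Implicit.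
Unset Printing Implicit Defensive.
Import Order.TTheory GRing.Theory Num.Theory.
Local Open Scope ring_scope.

(** Both families are compared above a threshold [M = 4 h], where [h = n / Q]
    for a large constant [Q]; what a member of either family does below [M]
    costs at most a factor [exp (O (M / ln n)) = exp (O (n / (Q ln n)))].

    The quantitative input is the Selberg upper bound sieve: if one residue
    class is removed modulo each prime [p <= z], then an interval of length
    [N] keeps at most [2 N / ln (z + 1) + z ^ 4] elements ([selberg_sieve],
    [card_sifted_le]).  With [z] about [n ^ (1/5)] this is [O (N / ln n)] plus a
    smaller error.  Consequently the part below [M] of a set whose elements larger
    than [z] avoid one class modulo each prime up to [z] (this holds for
    survivor sets and for admissible sets) is one of at most
    [T = (z + 1) ^ (z + 1) * 2 ^ (z + 1 + v)] sets, where [v] is the sieve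
    bound for [N = M + 1] ([card_traces_le]).

    Above [M] the two families have the same members.
    - The part above [M] of a survivor set is admissible: modulo a prime
      [p <= M] it avoids the class [r_p], and modulo a larger prime it has too
      few elements to fill all classes.  Hence [N_surv n <= T * A_adm n]
      ([N_surv_le]).
    - Conversely, let [A] be admissible, avoiding the class [c_p] modulo every
      prime [p].  Taking for [r_k] a lift of [c_p], where [p] is the least prime
      factor of [k], spares all of [A], but may also spare some other
      [t > M].  There are few such [t], and few elements in [A], by the sieve, so
      that one can greedily choose for each such [t] its own even modulus [k] in
      the interval from [M / 2] to [M] such that no element of [A] above [M] is
      congruent to [t] modulo [k]; resetting [r_k] to [t] kills [t] and spares
      [A] above [M].  Only even moduli larger than 2 are modified, so no prime
      condition is lost.  Hence [A_adm n <= T * N_surv n] ([survivors_above],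
      [A_adm_le]).

    Therefore the two logarithms differ by at most [ln T], which is
    [O (n / (Q ln n)) + o (n / ln n)], and [Q] is arbitrary. *)

(** * The Moebius function *)

(** A squarefree number has all its prime exponents equal to 1; by this
    definition 0 is squarefree too. *)
Definition squarefree (n : nat) : bool :=
  all (fun p => logn p n == 1)%N (primes n).

(** The Moebius function, with values in a ring; its value at 0 is 1. *)
Definition mobius (R : pzRingType) (n : nat) : R :=
  \prod_(p <- primes n) (if logn p n == 1%N then - 1 else 0).

Section Mobius.
Variable R : comPzRingType.
Implicit Types n d p : nat.

Lemma mobius1 : mobius R 1 = 1.
Proof. by rewrite /mobius big_nil. Qed.

Lemma mobius_sqr n : mobius R n ^+ 2 = (squarefree n)%:R.
Proof.
rewrite /mobius /squarefree; elim: (primes n) => [|p s IHs].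
  by rewrite big_nil expr1n.
rewrite big_cons exprMn IHs /=; case: (_ == _); first by rewrite sqrrN expr1n mul1r.
by rewrite expr0n mul0r.
Qed.

Lemma mobius_dvd_sqr p n : prime p -> (0 < n)%N -> (p ^ 2 %| n)%N -> mobius R n = 0.
Proof.
move=> p_pr n_gt0 p2n; rewrite /mobius (big_rem p) /=; last first.
  rewrite mem_primes p_pr n_gt0 /=.
  by rewrite (dvdn_trans _ p2n) // dvdn_exp.
by rewrite pfactor_dvdn // in p2n; case: eqP => [e|]; [rewrite e in p2n | rewrite mul0r].
Qed.

Lemma mobius_primeM p n :
  prime p -> (0 < n)%N -> ~~ (p %| n)%N -> mobius R (p * n) = - mobius R n.
Proof.
move=> p_pr n_gt0 npn; rewrite /mobius.
have perm_dvd : perm_eq (primes (p * n)) (p :: primes n).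
  apply: uniq_perm; rewrite ?primes_uniq //=.
    by rewrite primes_uniq mem_primes (negPf npn) !andbF.
  move=> q; rewrite primesM // ?prime_gt0 // inE; congr orb.
  by rewrite primes_prime // mem_seq1.
rewrite (perm_big _ perm_dvd) big_cons lognM // ?prime_gt0 //.
rewrite logn_prime // eqxx (_ : logn p n = 0%N); last first.
  by apply/eqP; rewrite -leqn0 leqNgt logn_gt0 mem_primes (negPf npn) !andbF.
rewrite addn0 /= mulN1r; congr (- _); apply: eq_big_seq => q.
rewrite mem_primes => /and3P [q_pr _ qn]; rewrite lognM // ?prime_gt0 //.
by rewrite logn_prime //; case: (q =P p) => // pq; rewrite -pq qn in npn.
Qed.

(** With [p] a prime factor of [n], the divisors divisible by [p] but not by
    [p ^ 2] cancel those prime to [p], and the other ones contribute 0. *)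
Lemma sum_mobius_divisors n :
  (0 < n)%N -> \sum_(d <- divisors n) mobius R d = (n == 1%N)%:R.
Proof.
move=> n_gt0; case: (eqVneq n 1%N) => [->|n_neq1].
  by rewrite big_seq1 mobius1.
have n_gt1 : (1 < n)%N by case: n n_gt0 n_neq1 => [|[]].
pose p := pdiv n; have p_pr : prime p by apply: pdiv_prime.
have pn : (p %| n)%N by apply: pdiv_dvd.
rewrite (bigID (fun d => p %| d)%N) /=.
rewrite (bigID (fun d => p ^ 2 %| d)%N) /= big1_seq ?add0r; last first.
  move=> d /andP[/andP[_ p2d]]; rewrite -dvdn_divisors // => dn.
  by apply: mobius_dvd_sqr p2d => //; apply: dvdn_gt0 dn.
rewrite -big_filter.
have perm_dvd : perm_eq [seq d <- divisors n | (p %| d)%N && ~~ (p ^ 2 %| d)%N]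
   [seq (p * d)%N | d <- divisors n & ~~ (p %| d)%N].
  apply: uniq_perm; first by rewrite filter_uniq // divisors_uniq.
    rewrite map_inj_uniq ?filter_uniq ?divisors_uniq //.
    by move=> a b /eqP; rewrite eqn_pmul2l ?prime_gt0 // => /eqP.
  move=> d; rewrite mem_filter -dvdn_divisors //; apply/idP/mapP.
    case/andP=> /andP[pd p2d] dn; exists (d %/ p)%N; last by rewrite mulnC divnK.
    rewrite mem_filter -dvdn_divisors //; apply/andP; split.
      apply: contra p2d => H; rewrite -(divnK pd) mulnC -mulnn.
      by rewrite dvdn_pmul2l ?prime_gt0.
    by apply: dvdn_trans dn; rewrite -{2}(divnK pd) dvdn_mulr.
  case=> x; rewrite mem_filter -dvdn_divisors // => /andP[px xn] ->.
  rewrite dvdn_mulr //= -mulnn dvdn_pmul2l ?prime_gt0 // px /=.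
  by rewrite Gauss_dvd ?pn ?xn // prime_coprime.
rewrite (perm_big _ perm_dvd) big_map big_filter -big_split /= big1_seq // => d.
case/andP=> pd; rewrite -dvdn_divisors // => dn.
by rewrite mobius_primeM ?addNr //; apply: dvdn_gt0 dn.
Qed.

(** The orthogonality relation behind Moebius inversion over multiples. *)
Lemma sum_mobius_between z e f : (0 < e)%N -> (0 < f <= z)%N ->
  \sum_(1 <= d < z.+1 | (e %| d)%N && (d %| f)%N) mobius R (f %/ d) = (e == f)%:R.
Proof.
move=> e_gt0 /andP[f_gt0 f_le]; rewrite -big_filter.
case: (boolP (e %| f)%N) => [ef | nef]; last first.
  rewrite big1_seq; last first.
    move=> d; rewrite mem_filter => /andP[_ /andP[/andP[ed df] _]].
    by rewrite (dvdn_trans ed df) in nef.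
  by case: eqP nef => // ->; rewrite dvdnn.
have fe_gt0 : (0 < f %/ e)%N by rewrite divn_gt0 // dvdn_leq.
have perm_dvd : perm_eq [seq d <- index_iota 1 z.+1 | (e %| d)%N && (d %| f)%N]
    [seq (f %/ h)%N | h <- divisors (f %/ e)].
  have hf h : h \in divisors (f %/ e) -> (h %| f)%N.
    rewrite -dvdn_divisors // => /dvdn_trans; apply.
    by rewrite -{2}(divnK ef) dvdn_mulr.
  apply: uniq_perm; first by rewrite filter_uniq // iota_uniq.
    rewrite map_inj_in_uniq ?divisors_uniq //.
    move=> a b /hf af /hf bf E.
    have a_gt0 : (0 < a)%N := dvdn_gt0 f_gt0 af.
    have fa_gt0 : (0 < f %/ a)%N by rewrite divn_gt0 // dvdn_leq.
    have Eab : (f %/ a * a = f %/ a * b)%N by rewrite (divnK af) E (divnK bf).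
    by apply/eqP; rewrite -(eqn_pmul2l fa_gt0) Eab.
  move=> d; rewrite mem_filter mem_index_iota ltnS; apply/idP/mapP.
    case/andP=> /andP[ed df] /andP[d_gt0 d_le]; exists (f %/ d)%N; last by rewrite divnA // mulKn.
    by rewrite -dvdn_divisors // -{2}(divnK df) -muln_divA // dvdn_mulr.
  case=> h hfe ->; have hf1 := hf _ hfe.
  have h_gt0 : (0 < h)%N by apply: dvdn_gt0 hf1.
  rewrite -dvdn_divisors // in hfe.
  rewrite divn_gt0 // dvdn_leq // (leq_trans (leq_div _ _)) // dvdn_div // andbT /=.
  by rewrite andbT dvdn_divRL // mulnC -dvdn_divRL.
rewrite (perm_big _ perm_dvd) big_map.
rewrite (eq_big_seq (mobius R)); last first.
  move=> h; rewrite -dvdn_divisors // => hfe; congr mobius.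
  have hf : (h %| f)%N by apply: dvdn_trans hfe _; rewrite -{2}(divnK ef) dvdn_mulr.
  by rewrite divnA // mulKn.
rewrite sum_mobius_divisors //; congr (_%:R); congr nat_of_bool.
by apply/eqP/eqP => [fe1|->]; [rewrite -(divnK ef) fe1 mul1n | rewrite divnn f_gt0].
Qed.

End Mobius.

Lemma squarefree_decomposition m :
  (0 < m)%N -> exists d k, [/\ squarefree d, (0 < d)%N, (0 < k)%N & m = (d * k ^ 2)%N].
Proof.
elim/ltn_ind: m => m IHm m_gt0.
case: (boolP (squarefree m)) => [sfm | ]; first by exists m, 1%N; rewrite muln1.
case/allPn => p; rewrite mem_primes => /and3P[p_pr _ pm] lp.
have p2m : (p ^ 2 %| m)%N.
  rewrite pfactor_dvdn //; have : (0 < logn p m)%N by rewrite logn_gt0 mem_primes p_pr m_gt0.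
  by case: (logn p m) lp => [|[]].
have p2_gt1 : (1 < p ^ 2)%N by rewrite -(exp1n 2) ltn_exp2r ?prime_gt1.
have m'_gt0 : (0 < m %/ p ^ 2)%N by rewrite divn_gt0 ?(ltnW p2_gt1) // dvdn_leq.
have [d [k [sd d_gt0 k_gt0 E]]] := IHm _ (ltn_Pdiv p2_gt1 m_gt0) m'_gt0.
exists d, (k * p)%N; split => //.
  by rewrite muln_gt0 k_gt0 prime_gt0.
by rewrite expnMn mulnA -E divnK.
Qed.

(** * The Selberg sieve *)

(** The number of multiples of [q] in an interval of length [N] starting at
    [a], as a difference of two quotients. *)
Lemma sum_multiples q a N : (0 < q)%N ->
  (\sum_(0 <= m < N) (q %| a + m) + (a + q.-1) %/ q = (a + N + q.-1) %/ q)%N.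
Proof.
move=> q_gt0; elim: N => [|N IHN]; first by rewrite big_geq // addn0.
rewrite big_nat_recr //= addnAC IHN addnS addSn divnS // [RHS]addnC; congr (_ + nat_of_bool _)%N.
by rewrite -addnS prednK // [in RHS]dvdn_addl.
Qed.

Lemma sum_totient_le z g : (0 < g <= z)%N ->
  (\sum_(1 <= e < z.+1 | e %| g) totient e = g)%N.
Proof.
case/andP=> g_gt0 g_le; rewrite (@big_cat_nat _ _ _ g.+1) //=.
rewrite [X in (_ + X)%N]big_nat_cond [X in (_ + X)%N]big1 ?addn0; last first.
  move=> e /andP[/andP[ge _] /(dvdn_leq g_gt0)]; rewrite leqNgt => /negP.
  by rewrite ge.
have := sum_totient_dvd g; rewrite -(big_mkord (fun e => e %| g)%N) /= big_ltn_cond //.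
by rewrite dvd0n eqn0Ngt g_gt0.
Qed.

Section Selberg.
Variables (R : realFieldType) (z : nat).
Hypothesis z_gt0 : (0 < z)%N.

(** The sum [L] of the inverses of the squarefree numbers up to [z]; its inverse
    is the bound that the sieve gives for the density of what remains. *)
Definition selberg_mass : R := \sum_(1 <= f < z.+1) mobius R f ^+ 2 / f%:R.

(** The sieve weights [lambda_d], chosen so that the sums
    [y_e = \sum_(e | d) lambda_d / d] of [selberg_weight_multiples] take the value
    [mobius e / (e L)].  The optimal choice would have the totient of [e] in
    place of [e], and would improve the result by a constant factor only. *)
Definition selberg_weight (d : nat) : R := d%:R / selberg_mass *
  \sum_(1 <= f < z.+1 | (d %| f)%N) mobius R (f %/ d) * (mobius R f / f%:R).

Lemma selberg_mass_ge1 : 1 <= selberg_mass.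
Proof.
rewrite /selberg_mass big_ltn ?ltnS // mobius1 expr1n divr1 lerDl.
by apply: sumr_ge0 => f _; rewrite mulr_ge0 ?sqr_ge0 // invr_ge0.
Qed.

Let L := selberg_mass.
Let lambda := selberg_weight.
Let L_gt0 : 0 < L. Proof. exact: lt_le_trans ltr01 selberg_mass_ge1. Qed.

Lemma selberg_weight1 : selberg_weight 1 = 1.
Proof.
rewrite /selberg_weight mul1r (eq_bigr (fun f => mobius R f ^+ 2 / f%:R)).
  by rewrite (eq_bigl xpredT) ?mulVf ?gt_eqF // => f; rewrite dvd1n.
by move=> f _; rewrite divn1 mulrA expr2.
Qed.

Lemma selberg_weight_norm d : (0 < d)%N -> `|selberg_weight d| <= d%:R.
Proof.
move=> d_gt0; rewrite /selberg_weight !normrM normfV (gtr0_norm L_gt0) normr_nat.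
rewrite -mulrA -[leRHS]mulr1 ler_wpM2l // mulrC ler_pdivrMr // mul1r.
apply: le_trans (ler_norm_sum _ _ _) _.
have mu1 n : `|mobius R n| <= 1.
  rewrite -(@ler_pXn2r _ 2) ?nnegrE // expr1n -normrX mobius_sqr.
  by case: (squarefree n); rewrite ?normr1 ?normr0.
rewrite /L /selberg_mass [leRHS](bigID (fun f => d %| f)%N) /= ler_wpDr //.
  by apply: sumr_ge0 => f _; rewrite mulr_ge0 ?sqr_ge0 // invr_ge0.
apply: ler_sum => f _; rewrite normrM normrM normfV normr_nat mulrA.
rewrite ler_wpM2r ?invr_ge0 //.
have := mobius_sqr R f; case: squarefree => E.
  by rewrite E -[leRHS]mul1r ler_pM.
by move/eqP: E; rewrite sqrf_eq0 => /eqP->; rewrite normr0 mulr0 sqr_ge0.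
Qed.

Lemma selberg_weight_multiples e : (0 < e <= z)%N ->
  \sum_(1 <= d < z.+1 | (e %| d)%N) selberg_weight d / d%:R
    = mobius R e / (e%:R * L).
Proof.
move=> /andP[e_gt0 e_le].
transitivity (L^-1 * \sum_(1 <= d < z.+1 | (e %| d)%N)
    \sum_(1 <= f < z.+1 | (d %| f)%N) mobius R (f %/ d) * (mobius R f / f%:R)).
  rewrite mulr_sumr big_nat_cond [RHS]big_nat_cond.
  apply: eq_bigr => d /andP[/andP[d_gt0 _] _]; rewrite /selberg_weight -/L.
  by rewrite mulrC !mulrA mulVf ?mul1r // pnatr_eq0 -lt0n.
rewrite (exchange_big_dep xpredT) //=.
rewrite (eq_big_nat _ _ (F2 := fun f => (e == f)%:R * (mobius R f / f%:R))); last first.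
  move=> f f_bd; rewrite -(@sum_mobius_between _ z) //.
  by rewrite mulr_suml.
rewrite (bigD1_seq e) ?iota_uniq ?mem_index_iota ?e_gt0 ?ltnS //=.
rewrite eqxx mul1r big1 ?addr0 => [|f fe]; last by rewrite eq_sym (negPf fe) mul0r.
by rewrite invfM mulrC mulrA.
Qed.

(** Writing [1 / lcm (d, d')] as [gcd (d, d') / (d d')], and the gcd as the sum of
    the totients of its divisors, turns the quadratic form into
    [\sum_e totient e * y_e ^ 2]. *)
Lemma selberg_form :
  \sum_(1 <= d < z.+1) \sum_(1 <= d' < z.+1)
     selberg_weight d * selberg_weight d' / (lcmn d d')%:R <= L^-1.
Proof.
pose x d := lambda d / d%:R.
have -> : \sum_(1 <= d < z.+1) \sum_(1 <= d' < z.+1)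
     selberg_weight d * selberg_weight d' / (lcmn d d')%:R =
   \sum_(1 <= e < z.+1) (totient e)%:R * (\sum_(1 <= d < z.+1 | (e %| d)%N) x d) ^+ 2.
  transitivity (\sum_(1 <= d < z.+1) \sum_(1 <= d' < z.+1) \sum_(1 <= e < z.+1)
      (totient e)%:R * ((if (e %| d)%N then x d else 0) * (if (e %| d')%N then x d' else 0))).
    apply: eq_big_nat => d /andP[d_gt0 d_le]; apply: eq_big_nat => d' /andP[d'_gt0 d'_le].
    transitivity (x d * x d' * (gcdn d d')%:R).
      rewrite /x -/lambda.
      have /(congr1 (fun n => n%:R : R)) := muln_lcm_gcd d d'; rewrite !natrM => E.
      have l0 : (lcmn d d')%:R != 0 :> R by rewrite pnatr_eq0 -lt0n lcmn_gt0 d_gt0.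
      have d0 : d%:R != 0 :> R by rewrite pnatr_eq0 -lt0n.
      have d'0 : d'%:R != 0 :> R by rewrite pnatr_eq0 -lt0n.
      have -> : (gcdn d d')%:R = d%:R * d'%:R / (lcmn d d')%:R :> R.
        by rewrite -E mulrC mulKf.
      by field; rewrite l0 d0 d'0.
    rewrite -[in LHS](@sum_totient_le z (gcdn d d')); last first.
      rewrite gcdn_gt0 d_gt0 /=; apply: (@leq_trans d) => //.
      by rewrite dvdn_leq // dvdn_gcdl.
    rewrite natr_sum mulr_sumr big_mkcond; apply: eq_bigr => e _.
    rewrite dvdn_gcd; case: (e %| d)%N; rewrite ?mul0r ?mulr0 //=.
    by case: (e %| d')%N; rewrite ?mulr0 // mulrC.
  under eq_bigr do rewrite exchange_big /=.
  rewrite exchange_big /=; apply: eq_bigr => e _.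
  rewrite expr2 [in RHS]big_mkcond big_distrlr mulr_sumr /=; apply: eq_bigr => d _.
  by rewrite mulr_sumr.
have -> : L^-1 = \sum_(1 <= e < z.+1) mobius R e ^+ 2 / e%:R / L ^+ 2.
  by rewrite -mulr_suml -/selberg_mass -/L expr2 invfM mulrA mulfV ?mul1r // gt_eqF.
apply: ler_sum_nat => e e_bd; rewrite selberg_weight_multiples //.
have /andP[e_gt0 _] := e_bd.
have te : (totient e)%:R <= e%:R :> R.
  rewrite ler_nat totient_count_coprime.
  by rewrite -[leqRHS]subn0 -[leqRHS]muln1 -sum_nat_const_nat leq_sum // => i _; case: coprime.
have e0 : e%:R != 0 :> R by rewrite pnatr_eq0 -lt0n.
have L0 : L != 0 by rewrite gt_eqF.
have -> : mobius R e ^+ 2 / e%:R / L ^+ 2 = e%:R * (mobius R e / (e%:R * L)) ^+ 2.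
  by field; rewrite e0 L0.
by rewrite ler_wpM2r // sqr_ge0.
Qed.

(** The square of the sum of the [lambda_d] over the [d <= z] dividing [a + m]
    is nonnegative, and is 1 when [a + m] has no prime factor up to [z].
    Summing over [m], the main term is [N] times the quadratic form, and the
    error is at most the square of the sum of the [`|lambda_d|]. *)
Theorem selberg_sieve (a N : nat) :
  (\sum_(0 <= m < N) [forall p : 'I_z.+1, prime p ==> ~~ (p %| a + m)])%N%:R
    <= N%:R / selberg_mass + (z ^ 4)%:R.
Proof.
have count_mult q : (0 < q)%N ->
    `|(\sum_(0 <= m < N) (q %| a + m))%N%:R - N%:R / q%:R| <= 1 :> R.
  move=> q_gt0; have := sum_multiples a N q_gt0; set c := (\sum_(_ <= _ < _) _)%N.
  move=> E; have q0 : 0 < q%:R :> R by rewrite ltr0n.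
  have H1 : (c * q <= N + q)%N by nia.
  have H2 : (N <= c * q + q)%N by nia.
  rewrite -(ler_nat R) natrD natrM in H1; rewrite -(ler_nat R) natrD natrM in H2.
  rewrite ler_norml; apply/andP; split.
    by rewrite lerBrDl lerBlDr ler_pdivrMr // mulrDl mul1r.
  by rewrite lerBlDr -(ler_pM2r q0) mulrDl mul1r divfK ?gt_eqF // addrC.
pose V m := \sum_(1 <= d < z.+1) (if (d %| a + m)%N then lambda d else 0).
have le_V : (\sum_(0 <= m < N) [forall p : 'I_z.+1, prime p ==> ~~ (p %| a + m)])%N%:R
    <= \sum_(0 <= m < N) V m ^+ 2.
  rewrite natr_sum; apply: ler_sum => m _; case: forallP => [Hm|_]; last exact: sqr_ge0.
  rewrite /V big_ltn ?ltnS // dvd1n /lambda selberg_weight1 big_nat big1 ?addr0 ?expr1n //.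
  move=> d /andP[d_gt1 d_le]; case: ifP => // dm.
  have p_lt : (pdiv d < z.+1)%N by rewrite (leq_ltn_trans _ d_le) // pdiv_leq // ltnW.
  have /implyP/(_ (pdiv_prime d_gt1))/negP[] := Hm (Ordinal p_lt).
  exact: dvdn_trans (pdiv_dvd d) dm.
apply: le_trans le_V _.
have -> : \sum_(0 <= m < N) V m ^+ 2 = \sum_(1 <= d < z.+1) \sum_(1 <= d' < z.+1)
    lambda d * lambda d' * (\sum_(0 <= m < N) (lcmn d d' %| a + m))%N%:R.
  under eq_bigr do rewrite expr2 big_distrlr /=.
  rewrite exchange_big /=; apply: eq_bigr => d _.
  rewrite exchange_big /=; apply: eq_bigr => d' _.
  rewrite natr_sum mulr_sumr; apply: eq_bigr => m _; rewrite dvdn_lcm.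
  by case: (d %| a + m)%N; case: (d' %| a + m)%N; rewrite ?mulr1 ?mulr0 ?mul0r.
have -> : (z ^ 4)%:R = \sum_(1 <= d < z.+1) \sum_(1 <= d' < z.+1) (z%:R * z%:R) :> R.
  rewrite !sumr_const_nat subn1 /= -natrM -!mulrnA.
  by congr (_%:R); rewrite !expnS expn0 muln1 !mulnA.
apply: le_trans (_ : N%:R * (\sum_(1 <= d < z.+1) \sum_(1 <= d' < z.+1)
     selberg_weight d * selberg_weight d' / (lcmn d d')%:R) +
    \sum_(1 <= d < z.+1) \sum_(1 <= d' < z.+1) (z%:R * z%:R) <= _); last first.
  by rewrite lerD2r ler_wpM2l // selberg_form.
rewrite mulr_sumr -big_split /=; apply: ler_sum_nat => d /andP[d_gt0 d_le].
rewrite mulr_sumr -big_split /=; apply: ler_sum_nat => d' /andP[d'_gt0 d'_le].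
have l_gt0 : (0 < lcmn d d')%N by rewrite lcmn_gt0 d_gt0.
rewrite -lerBlDl.
rewrite [N%:R * _]mulrCA -mulrBr.
apply: le_trans (ler_norm _) _; rewrite normrM -[leRHS]mulr1.
apply: ler_pM => //; last exact: count_mult.
rewrite normrM ler_pM //; apply: le_trans (selberg_weight_norm _) _ => //.
  by rewrite ler_nat.
by rewrite ler_nat.
Qed.

End Selberg.

(** * Removing arbitrary residue classes *)

Lemma sum_inv_sqr (R : realFieldType) z :
  \sum_(1 <= k < z.+1) (k%:R ^+ 2)^-1 <= 2 :> R.
Proof.
suff H : (0 < z)%N -> \sum_(1 <= k < z.+1) (k%:R ^+ 2)^-1 <= 2 - z%:R^-1 :> R.
  case: z H => [|z] H; first by rewrite big_geq.
  by apply: le_trans (H _) _; rewrite // gerBl.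
elim: z => // -[|z] IHz _; first by rewrite big_nat1 expr1n invr1; lra.
rewrite big_nat_recr //=; apply: le_trans (lerD (IHz isT) (lexx _)) _.
have z0 : 0 < z.+1%:R :> R by rewrite ltr0n.
rewrite -[z.+2%:R]natr1; set t := z.+1%:R in z0 *.
suff : (t + 1) ^- 2 <= t^-1 - (t + 1)^-1.
  by move: (_ ^- 2) (t^-1) ((t + 1)^-1) => x y w; lra.
have -> : t^-1 - (t + 1)^-1 = (t * (t + 1))^-1 by field; apply/andP; split; lra.
by rewrite lef_pV2 ?posrE ?exprn_gt0 ?mulr_gt0 //; [nra | lra..].
Qed.

(** Each [m <= z] is a squarefree number times a square, and the inverse squares
    sum to at most 2. *)
Lemma harmonic_le_selberg_mass (R : realFieldType) z :
  \sum_(1 <= m < z.+1) m%:R^-1 <= 2 * selberg_mass R z.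
Proof.
pose F d k : R := mobius R d ^+ 2 / d%:R * (k%:R ^+ 2)^-1.
have F_ge0 d k : 0 <= F d k by rewrite /F mobius_sqr !mulr_ge0 ?invr_ge0 ?exprn_ge0.
apply: (@le_trans _ _ (\sum_(1 <= d < z.+1) \sum_(1 <= k < z.+1) F d k)); last first.
  rewrite mulrC /selberg_mass mulr_suml; apply: ler_sum => d _.
  by rewrite -mulr_sumr ler_wpM2l ?sum_inv_sqr // mobius_sqr mulr_ge0 ?invr_ge0.
apply: (@le_trans _ _ (\sum_(1 <= m < z.+1) \sum_(1 <= d < z.+1) \sum_(1 <= k < z.+1)
   (if m == (d * k ^ 2)%N then F d k else 0))).
  apply: ler_sum_nat => m /andP[m_gt0 m_le].
  have [d [k [sd d_gt0 k_gt0 E]]] := squarefree_decomposition m_gt0.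
  have k_lt : (k < z.+1)%N.
    apply: leq_ltn_trans m_le; rewrite E -mulnn mulnA -{1}[k]mul1n leq_mul //.
    by rewrite muln_gt0 d_gt0.
  have d_lt : (d < z.+1)%N.
    by apply: leq_ltn_trans m_le; rewrite E -{1}[d]muln1 leq_mul // expn_gt0 k_gt0.
  rewrite (bigD1_seq d) ?iota_uniq ?mem_index_iota ?d_gt0 //=.
  rewrite (bigD1_seq k) ?iota_uniq ?mem_index_iota ?k_gt0 //=.
  rewrite -E eqxx {1}/F mobius_sqr sd mul1r -invfM -natrX -natrM -E -addrA lerDl.
  rewrite addr_ge0 // ?sumr_ge0 // => i _; first by case: ifP.
  by rewrite sumr_ge0 // => j _; case: ifP.
rewrite exchange_big /=; apply: ler_sum => d _.
rewrite exchange_big /=; apply: ler_sum => k _.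
rewrite -big_mkcond /= -big_filter.
have : uniq [seq m <- index_iota 1 z.+1 | m == (d * k ^ 2)%N] by rewrite filter_uniq ?iota_uniq.
have : all (pred1 (d * k ^ 2)%N) [seq m <- index_iota 1 z.+1 | m == (d * k ^ 2)%N].
  exact: filter_all.
case: [seq _ <- _ | _] => [|x [|y s]]; first by rewrite big_nil.
  by rewrite big_seq1.
by move=> /= /and3P[/eqP-> /eqP-> _]; rewrite inE eqxx.
Qed.

Lemma ln_le_harmonic (R : realType) z : ln z.+1%:R <= \sum_(1 <= m < z.+1) m%:R^-1 :> R.
Proof.
elim: z => [|z IHz]; first by rewrite big_geq // ln1.
rewrite big_nat_recr //=.
have z0 : 0 < z.+1%:R :> R by rewrite ltr0n.
have -> : z.+2%:R = z.+1%:R * (1 + z.+1%:R^-1) :> R.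
  by rewrite mulrDr mulr1 mulfV ?gt_eqF // natr1.
have i0 : 0 < z.+1%:R^-1 :> R by rewrite invr_gt0.
rewrite lnM ?posrE ?addr_gt0 //; apply: lerD => //.
by apply: le_ln1Dx; apply: lt_trans i0; rewrite oppr_lt0.
Qed.

Lemma ln_le_selberg_mass (R : realType) z : ln z.+1%:R <= 2 * selberg_mass R z.
Proof. exact: le_trans (ln_le_harmonic R z) (harmonic_le_selberg_mass R z). Qed.

Lemma chinese_primes (c : nat -> nat) (z : nat) :
  exists s, forall p, prime p -> (p <= z)%N -> s = c p %[mod p].
Proof.
elim: z => [|z [s Hs]].
  by exists 0%N => p p_pr; rewrite leqn0 => /eqP p0; rewrite p0 in p_pr.
case: (boolP (prime z.+1)) => z_pr; last first.
  exists s => p p_pr; rewrite leq_eqVlt => /orP[/eqP pz|]; last exact: Hs.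
  by rewrite -pz p_pr in z_pr.
have co : coprime z`! z.+1.
  rewrite coprime_sym prime_coprime // fact_prod Euclid_dvd_prod // big_has_cond.
  rewrite -all_predC; apply/allP => i; rewrite mem_index_iota /= => /andP[i_gt0 i_lt].
  by rewrite gtnNdvd.
exists (chinese z`! z.+1 s (c z.+1)) => p p_pr; rewrite leq_eqVlt => /orP[/eqP->|].
  exact: chinese_modr.
rewrite ltnS => p_le; rewrite -(Hs p p_pr p_le).
have pz : (p %| z`!)%N by rewrite dvdn_fact // prime_gt0.
by rewrite -(modn_dvdm _ pz) chinese_modl // modn_dvdm.
Qed.

(** The number [m] avoids the class of [c p] modulo every prime [p <= z]. *)
Definition sifted (c : nat -> nat) (z m : nat) : bool :=
  [forall p : 'I_z.+1, prime p ==> (m != c p %[mod p])].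

Lemma siftedP c z m :
  reflect (forall p, prime p -> (p <= z)%N -> m <> c p %[mod p]) (sifted c z m).
Proof.
apply: (iffP forallP) => [H p p_pr p_le | H p].
  by apply/eqP; have /implyP := H (Ordinal (p_le : (p < z.+1)%N)); apply.
by apply/implyP => p_pr; apply/eqP/H => //; rewrite -ltnS.
Qed.

(** By the Chinese remainder theorem a translation reduces arbitrary classes to
    the class of 0. *)
Theorem card_sifted_le (R : realType) c z N : (0 < z)%N ->
  #|[set m : 'I_N | sifted c z m]|%:R <= 2 * N%:R / ln z.+1%:R + (z ^ 4)%:R :> R.
Proof.
move=> z_gt0.
have [s Hs] := chinese_primes (fun p => p - c p %% p)%N z.
have ln_gt0 : 0 < ln z.+1%:R :> R by rewrite ln_gt0 // ltr1n.
apply: (@le_trans _ _ (N%:R / selberg_mass R z + (z ^ 4)%:R)); last first.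
  rewrite lerD2r mulrAC -[leRHS]mulrC ler_wpM2l //.
  rewrite ler_pdivlMr // mulrC ler_pdivrMr ?ln_le_selberg_mass //.
  by apply: lt_le_trans (selberg_mass_ge1 _ z_gt0).
apply: le_trans (selberg_sieve R z_gt0 s N).
rewrite ler_nat -sum1dep_card big_mkcond /= big_mkord; apply: leq_sum => m _.
case: siftedP => // Hm; rewrite lt0b; apply/forallP => p; apply/implyP => p_pr.
apply/negP => psm; apply: (Hm p p_pr); first by rewrite -ltnS.
have /eqP := Hs p p_pr (ltn_ord p : (p < z.+1)%N).
rewrite -(eqn_modDr m) => /eqP E; move: psm; rewrite /dvdn E => /eqP E2.
have c_le : (c p %% p <= p)%N by rewrite ltnW // ltn_pmod // prime_gt0.
apply/eqP; rewrite -(eqn_modDl (p - c p %% p)) E2.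
by rewrite -modnDmr subnK // modnn.
Qed.

(** * Comparing the two families *)

(** A set is determined by its parts inside and outside [L]. *)
Lemma card_split_le (T : finType) (L : {set T}) (F G E : {set {set T}}) :
  (forall A, A \in F -> A :&: L \in E) ->
  (forall A, A \in F -> exists2 B, B \in G & B :\: L = A :\: L) ->
  (#|F| <= #|E| * #|G|)%N.
Proof.
move=> FE FG; pose split (A : {set T}) := (A :&: L, A :\: L).
have split_inj : injective split.
  by move=> A B [E1 E2]; rewrite -(setID A L) -(setID B L) E1 E2.
rewrite -(card_imset _ split_inj).
apply: (@leq_trans #|setX E [set B :\: L | B in G]|); last first.
  by rewrite cardsX leq_mul2l leq_imset_card orbT.
apply/subset_leq_card/fintype.subsetP => _ /imsetP[A AF ->].
rewrite in_setX FE //=; have [B BG <-] := FG A AF; exact: imset_f.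
Qed.

(** Greedy choice of distinct values outside small forbidden sets; [i0] is only
    needed to define the function when [D] is empty. *)
Lemma injective_avoiding (T I : finType) (i0 : I) (D : {set T}) (bad : T -> {set I}) :
  (forall t, t \in D -> (#|bad t| + #|D| <= #|I|)%N) ->
  exists f : T -> I, {in D &, injective f} /\ forall t, t \in D -> f t \notin bad t.
Proof.
have [n] := ubnP #|D|; elim: n D => // n IHn D D_lt bad_le.
case: (set_0Vmem D) => [-> | [x xD]].
  by exists (fun=> i0); split => [s t|t]; rewrite inE.
have cD : #|D| = #|D :\ x|.+1 by rewrite (cardsD1 x D) xD.
have [||f [f_inj f_bad]] := IHn (D :\ x).
- by rewrite cD ltnS in D_lt.
- move=> t /setD1P[_ /bad_le]; rewrite cD; lia.
have [i iP] : exists i, i \notin bad x :|: f @: (D :\ x).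
  apply/existsP; rewrite -negb_forall; apply/negP => /forallP H.
  have := bad_le x xD; have : (#|I| <= #|bad x :|: f @: (D :\ x)|)%N.
    by apply/subset_leq_card/fintype.subsetP => j _; exact: H.
  have := leq_imset_card f (D :\ x); have := cardsU (bad x) (f @: (D :\ x)).
  lia.
move: iP; rewrite inE negb_or => /andP[i_bad i_im].
exists (fun t => if t == x then i else f t); split; last first.
  by move=> t tD; case: eqP => [->//|/eqP tx]; apply: f_bad; rewrite !inE tx.
have im t : t \in D -> t != x -> f t <> i.
  by move=> tD tx E; case/negP: i_im; rewrite -E imset_f // !inE tx.
move=> s t sD tD; case: eqP => [->|/eqP sx]; case: eqP => [->|/eqP tx] //.
- by move=> /esym /im; move=> /(_ tD tx).
- by move=> /im; move=> /(_ sD sx).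
- by apply: f_inj; rewrite !inE ?sx ?tx.
Qed.

(** The profile whose residue modulo [k] is the class of [rho k]. *)
Definition profile_of n (rho : nat -> nat) : profile n :=
  [ffun j : 'I_n.-1 => (rho j.+2)%:R : 'Z_(j.+2)].

Lemma profile_ofP n (r : profile n) : exists rho, r = profile_of n rho.
Proof.
exists (fun k => if insub k.-2 is Some j then val (r j) else 0%N).
by apply/ffunP => j; rewrite ffunE /= valK natr_Zp.
Qed.

Lemma survivors_profile_of n rho (m : 'I_n.+2) :
  reflect ((2 <= m)%N /\ forall k, (2 <= k < m)%N -> m <> rho k %[mod k])
    (m \in survivors (profile_of n rho)).
Proof.
rewrite !inE; apply: (iffP andP) => -[m_ge2 H]; split => //.
  case=> [|[|k]] // /= k_lt; have k_n : (k < n.-1)%N by have := ltn_ord m; lia.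
  have /forallP/(_ (Ordinal k_n))/implyP/(_ k_lt) := H.
  rewrite ffunE /= -val_eqE /= => /eqP.
  by rewrite !val_Zp_nat.
apply/forallP => j; apply/implyP => j_lt; rewrite ffunE -val_eqE /=.
by apply/eqP; rewrite !val_Zp_nat //; apply: H.
Qed.

Lemma prime_admissibleP n (A : {set 'I_n.+2}) : prime_admissible A ->
  exists c : nat -> nat, forall p (m : 'I_n.+2), prime p -> m \in A -> m <> c p %[mod p].
Proof.
move=> admA; suff /boolp.choice[c cP] : forall p, exists x,
    forall m : 'I_n.+2, prime p -> m \in A -> m <> x %[mod p].
  by exists c => p m; apply: cP.
move=> p; case: (boolP (prime p)) => p_pr; last by exists 0%N.
have := admA p p_pr; rewrite -properT => /properP[_ [x _ xA]].
exists (val x) => m _ mA E; case/negP: xA; apply/imsetP; exists m => //.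
apply: val_inj; rewrite /= val_Zp_nat ?prime_gt1 // E modn_small //.
by apply: leq_trans (ltn_ord x) _; rewrite Zp_cast ?prime_gt1.
Qed.

(** Modulo the primes larger than the cardinal of [A] there is nothing to
    check. *)
Lemma avoid_prime_admissible n (A : {set 'I_n.+2}) (h M : nat) (c : nat -> nat) :
  (h <= M)%N -> (#|A| <= h)%N ->
  (forall p (m : 'I_n.+2), prime p -> (p <= M)%N -> m \in A -> m <> c p %[mod p]) ->
  prime_admissible A.
Proof.
move=> hM cardA cP p p_pr; have p_gt1 := prime_gt1 p_pr.
case: (leqP p M) => pM; last first.
  apply/eqP => E; have := leq_imset_card (fun m : 'I_n.+2 => (m : nat)%:R : 'Z_p) A.
  rewrite E cardsT card_ord Zp_cast // => pA.
  by have := leq_trans (leq_trans pA cardA) hM; rewrite leqNgt pM.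
apply/eqP/setP => /(_ (c p)%:R); rewrite inE => /imsetP[m mA /(congr1 val)] /=.
by rewrite !val_Zp_nat // => E; apply: (cP p m) => //; rewrite E.
Qed.

(** The subsets of [{0, ..., M}] whose elements larger than [z] avoid one class
    modulo each prime [p <= z].  The classes are given by a function on
    [{0, ..., z}], so that there are finitely many choices; only its values at
    primes matter. *)
Definition traces n z M : {set {set 'I_n.+2}} :=
  \bigcup_(c : {ffun 'I_z.+1 -> 'I_z.+1})
    powerset [set m : 'I_n.+2 | (m <= M)%N &&
      ((m <= z)%N || sifted (fun p => c (inord p)) z m)].

Lemma trace_in n z M c (A : {set 'I_n.+2}) :
  (forall m : 'I_n.+2, m \in A -> (z < m)%N -> sifted c z m) ->
  A :&: [set m : 'I_n.+2 | (m <= M)%N] \in traces n z M.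
Proof.
move=> Ac; apply/bigcupP.
exists [ffun p : 'I_z.+1 => inord (c p %% p) : 'I_z.+1] => //.
rewrite powersetE; apply/fintype.subsetP => m; rewrite !inE => /andP[mA ->] /=.
case: leqP => //= zm; apply/siftedP => p p_pr p_le; rewrite ffunE.
have lt_z : (c p %% p < z.+1)%N.
  by rewrite ltnS (leq_trans _ p_le) // ltnW // ltn_pmod // prime_gt0.
by rewrite inordK // inordK // modn_mod; apply: (siftedP _ _ _ (Ac m mA zm)).
Qed.

Lemma card_traces_le n z M v :
  (forall c, #|[set m : 'I_M.+1 | sifted c z m]| <= v)%N ->
  (#|traces n z M| <= z.+1 ^ z.+1 * 2 ^ (z.+1 + v))%N.
Proof.
move=> v_le; have -> : (z.+1 ^ z.+1)%N = #|{ffun 'I_z.+1 -> 'I_z.+1}|.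
  by rewrite card_ffun card_ord.
rewrite -sum_nat_const /traces; apply: (big_ind2 (fun (B : {set _}) k => #|B| <= k)%N).
- by rewrite cards0.
- by move=> B1 k1 B2 k2 H1 H2; apply: leq_trans (leq_card_setU _ _) (leq_add H1 H2).
move=> c _; rewrite card_powerset leq_exp2l //.
set c' := fun p : nat => _ : nat.
pose lo := [set m : 'I_n.+2 | (m <= z)%N].
pose hi := [set m : 'I_n.+2 | (m <= M)%N && sifted c' z m].
apply: (@leq_trans #|lo :|: hi|).
  by apply/subset_leq_card/fintype.subsetP => m; rewrite !inE => /andP[-> ->].
rewrite cardsU; apply: leq_trans (leq_subr _ _) _; apply: leq_add.
  rewrite -[leqRHS]card_ord -(card_in_imset (f := fun m : 'I_n.+2 => inord m : 'I_z.+1)).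
    exact: max_card.
  move=> x y; rewrite !inE => xz yz /(congr1 val); rewrite /= !inordK //.
  exact: val_inj.
apply: leq_trans (v_le c').
rewrite -(card_in_imset (f := fun m : 'I_n.+2 => inord m : 'I_M.+1) (D := hi)).
  apply/subset_leq_card/fintype.subsetP => _ /imsetP[m + ->].
  by rewrite !inE => /andP[mM ms]; rewrite inordK.
move=> x y; rewrite !inE => /andP[xM _] /andP[yM _] /(congr1 val); rewrite /= !inordK //.
exact: val_inj.
Qed.

(** In this section [4 * h] is the threshold above which the two families are
    matched, [u] bounds the size of sifted subsets of the whole range, and [v]
    that of sifted subsets below the threshold. *)
Section Comparison.
Variables n h Q z u v : nat.
Hypothesis h_gt0 : (0 < h)%N.
Hypothesis z_le : (z <= 4 * h)%N.
Hypothesis n_lt : (n < h.+1 * Q)%N.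
Hypothesis u_le : (u * Q + u <= h)%N.
Hypothesis sift_u : forall c, (#|[set m : 'I_n.+2 | sifted c z m]| <= u)%N.
Hypothesis sift_v : forall c, (#|[set m : 'I_(4 * h).+1 | sifted c z m]| <= v)%N.

Let M := (4 * h)%N.
Let low : {set 'I_n.+2} := [set m : 'I_n.+2 | (m <= M)%N].
Let admissible_sets : {set {set 'I_n.+2}} :=
  [set A : {set 'I_n.+2} | (A \subset X_set n) && `[< prime_admissible A >]].

Lemma N_surv_le : (N_surv n <= z.+1 ^ z.+1 * 2 ^ (z.+1 + v) * A_adm n)%N.
Proof.
apply: leq_trans (leq_mul (@card_traces_le n z M v sift_v) (leqnn _)).
apply: (@card_split_le _ low) => S /imsetP[r _ ->].
  have [rho ->] := profile_ofP r; apply: (@trace_in _ _ _ rho) => m.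
  case/survivors_profile_of => m_ge2 mP zm; apply/siftedP => p p_pr p_le.
  by apply: mP; rewrite prime_gt1 // (leq_ltn_trans p_le).
have [rho ->] := profile_ofP r; set S' := survivors _.
exists (S' :\: low); last by rewrite setDDl setUid.
have S'P (m : 'I_n.+2) : m \in S' :\: low ->
    (M < m)%N /\ forall k, (2 <= k < m)%N -> m <> rho k %[mod k].
  by rewrite inE => /andP[m_low /survivors_profile_of[_ ?]]; rewrite inE -ltnNge in m_low.
rewrite inE; apply/andP; split.
  apply/fintype.subsetP => m; rewrite inE => /andP[_ /survivors_profile_of[? _]].
  by rewrite inE.
apply/boolp.asboolP; apply: (@avoid_prime_admissible _ _ u M rho).
- by rewrite /M; nia.
- apply: leq_trans (sift_u rho); apply/subset_leq_card/fintype.subsetP => m.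
  case/S'P => mM mP; rewrite inE; apply/siftedP => p p_pr p_le.
  by apply: mP; rewrite prime_gt1 // (leq_ltn_trans p_le) // (leq_ltn_trans z_le).
- move=> p m p_pr p_le /S'P[mM mP]; apply: mP.
  by rewrite prime_gt1 // (leq_ltn_trans p_le).
Qed.

(** Every admissible set agrees above the threshold with a survivor set. *)
Lemma survivors_above (A : {set 'I_n.+2}) : A \in admissible_sets ->
  exists r : profile n, survivors r :\: low = A :\: low.
Proof.
rewrite inE => /andP[A_X /boolp.asboolP /prime_admissibleP[c cP]].
(* the even moduli in the interval from [2 h + 2] to [4 h] *)
pose modulus (i : 'I_h) := (2 * (h.+1 + i))%N.
(* the elements spared by the residues [c p] at all primes [p < t] *)
pose D := [set t : 'I_n.+2 | [&& (M < t)%N, t \notin A & sifted c t.-1 t]].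
pose bad (t : 'I_n.+2) := [set i : 'I_h |
  [exists a : 'I_n.+2, [&& a \in A, (M < a)%N & a == t %[mod modulus i]]]].
have sub_u (B : {set 'I_n.+2}) : (forall m, m \in B -> sifted c z m) -> (#|B| <= u)%N.
  move=> Bs; apply: leq_trans (sift_u c); apply/subset_leq_card/fintype.subsetP => m.
  by move/Bs; rewrite inE.
have bad_le t : t \in D -> (#|bad t| + #|D| <= #|'I_h|)%N.
  rewrite inE => /and3P[Mt tA _]; rewrite card_ord; apply: leq_trans u_le.
  apply: leq_add; last first.
    apply: sub_u => m; rewrite inE => /and3P[Mm _ /siftedP ms]; apply/siftedP => p p_pr p_le.
    by apply: ms => //; rewrite -ltnS prednK; lia.
  pose AM := [set a in A | (M < a)%N].
  (* A bad index [i] is recovered from [a] and from the quotient of the distance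
     between [a] and [t] by [modulus i]; this quotient is less than [Q]. *)
  pose dist (a : 'I_n.+2) := ((a - t) + (t - a))%N.
  pose g (x : 'I_n.+2 * 'I_Q) : option 'I_h := insub ((dist x.1 %/ x.2)./2 - h.+1)%N.
  have Some_inj : injective (@Some 'I_h) by move=> x y [].
  rewrite -(card_imset _ Some_inj).
  apply: (@leq_trans #|g @: setX AM [set: 'I_Q]|).
    apply/subset_leq_card/fintype.subsetP => _ /imsetP[i + ->].
    rewrite inE => /existsP[a /and3P[aA aM aE]].
    have dvd_dist : (modulus i %| dist a)%N.
      rewrite /dist; case: (leqP a t) => [le_at | /ltnW le_ta].
        by rewrite (eqP le_at) add0n -eqn_mod_dvd // eq_sym.
      by rewrite (eqP le_ta) addn0 -eqn_mod_dvd.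
    have dist_gt0 : (0 < dist a)%N.
      rewrite lt0n addn_eq0 !subn_eq0 -eqn_leq; apply: contraNneq tA => at_eq.
      by rewrite -(val_inj at_eq).
    have dist_le : (dist a <= n)%N.
      by rewrite /dist; have := ltn_ord a; have := ltn_ord t; lia.
    have mod_gt0 : (0 < modulus i)%N by [].
    have j_gt0 : (0 < dist a %/ modulus i)%N by rewrite divn_gt0 // dvdn_leq.
    have j_lt : (dist a %/ modulus i < Q)%N.
      by rewrite ltn_divLR // (leq_ltn_trans dist_le) // (leq_trans n_lt) // /modulus; nia.
    apply/imsetP; exists (a, Ordinal j_lt); first by rewrite in_setX in_setT inE aA aM.
    rewrite /g /= divnA // mulKn // /modulus mul2n doubleK addKn.
    by rewrite -[nat_of_ord i]/(val i) valK.
  apply: leq_trans (leq_imset_card _ _) _; rewrite cardsX cardsT card_ord leq_mul2r.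
  apply/orP; right; apply: sub_u => a; rewrite inE => /andP[aA _].
  by apply/siftedP => p p_pr _; apply: cP.
have [f [f_inj f_bad]] := injective_avoiding (Ordinal h_gt0) bad_le.
pose rho k := if [pick t in D | k == modulus (f t)] is Some t then val t else c (pdiv k).
have modulus_le t : (modulus (f t) <= M)%N by rewrite /modulus /M; have := ltn_ord (f t); lia.
have rho_dvd k m : m = rho k %[mod k] -> (1 < k)%N ->
    (exists2 t, t \in D & k = modulus (f t) /\ m = t %[mod k]) \/ m = c (pdiv k) %[mod pdiv k].
  rewrite /rho; case: pickP => [t /andP[tD /eqP kE] mE _|_ mE _]; first by left; exists t.
  by right; rewrite -(modn_dvdm _ (pdiv_dvd k)) mE modn_dvdm // pdiv_dvd.
exists (profile_of n rho); apply/setP => m; rewrite !in_setD.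
have [//|] := boolP (m \in low); rewrite inE -ltnNge => Mm /=.
have m_ge2 : (2 <= m)%N by move: Mm; rewrite /M; lia.
apply/idP/idP => [/survivors_profile_of[_ mP] | mA]; last first.
  apply/survivors_profile_of; split => // k /andP[k_gt1 _] /rho_dvd[//|[t tD [kE mt]]|].
    case/negP: (f_bad t tD); rewrite inE; apply/existsP; exists m.
    by rewrite mA Mm -kE; apply/eqP.
  by apply: cP => //; apply: pdiv_prime.
apply/negPn/negP => mA.
have [mD | mD] := boolP (m \in D).
  apply: (mP (modulus (f m))); first by rewrite (leq_ltn_trans (modulus_le m)) // /modulus; lia.
  rewrite /rho; case: pickP => [t /andP[tD /eqP ft]|/(_ m)]; last by rewrite mD eqxx.
  suff -> : m = t by [].
  apply: f_inj => //; apply: val_inj.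
  by move: ft; rewrite /modulus /=; lia.
move: mD; rewrite inE Mm mA /= => /siftedP; apply => p p_pr p_le mc.
have p_lt : (p < m)%N by rewrite -(ltn_predK Mm).
apply: (mP p); first by rewrite prime_gt1.
rewrite /rho; case: pickP => [t /andP[_ /eqP pE]|_]; last by rewrite pdiv_id.
(* a modified modulus is even and larger than 2, hence not a prime *)
have p2 : p = 2%N.
  by apply/eqP; rewrite eq_sym -(@dvdn_prime2 2 p) // pE dvdn_mulr.
by move: pE; rewrite p2 /modulus; lia.
Qed.

Lemma A_adm_le : (A_adm n <= z.+1 ^ z.+1 * 2 ^ (z.+1 + v) * N_surv n)%N.
Proof.
apply: leq_trans (leq_mul (@card_traces_le n z M v sift_v) (leqnn _)).
apply: (@card_split_le _ low) => A A_adm.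
  move: A_adm; rewrite inE => /andP[_ /boolp.asboolP /prime_admissibleP[c cP]].
  apply: (@trace_in _ _ _ c) => m mA _.
  by apply/siftedP => p p_pr _; apply: cP.
have [r rP] := survivors_above A_adm.
by exists (survivors r) => //; apply: imset_f.
Qed.

End Comparison.

(** * Asymptotics *)

Lemma ln_ratio_le (R : realType) (a b t : nat) :
  (0 < a)%N -> (0 < b)%N -> (0 < t)%N -> (a <= t * b)%N -> (b <= t * a)%N ->
  `|ln a%:R - ln b%:R| <= ln t%:R :> R.
Proof.
move=> a_gt0 b_gt0 t_gt0 ab ba.
have H x y : (0 < x)%N -> (0 < y)%N -> (x <= t * y)%N ->
    ln x%:R <= ln t%:R + ln y%:R :> R.
  move=> x_gt0 y_gt0 xy; rewrite -lnM ?posrE ?ltr0n // -natrM.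
  by rewrite ler_ln ?posrE ?ltr0n ?muln_gt0 ?t_gt0 // ler_nat.
have Hab := H a b a_gt0 b_gt0 ab; have Hba := H b a b_gt0 a_gt0 ba.
by rewrite ler_norml; apply/andP; split; lra.
Qed.

Lemma N_surv_gt0 n : (0 < N_surv n)%N.
Proof.
by apply/card_gt0P; exists (survivors (profile_of n id)); apply: imset_f.
Qed.

Lemma A_adm_gt0 n : (0 < A_adm n)%N.
Proof.
apply/card_gt0P; exists set0; rewrite inE sub0set /=; apply/boolp.asboolP => p p_pr.
by rewrite imset0 eq_sym -card_gt0 cardsT card_ord.
Qed.

Lemma ln_trace_count_le (R : realType) z v :
  ln (z.+1 ^ z.+1 * 2 ^ (z.+1 + v))%:R <= z.+1%:R ^+ 2 + z.+1%:R + v%:R :> R.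
Proof.
have ln_le m : (0 < m)%N -> ln m%:R <= m%:R :> R.
  by move=> m_gt0; rewrite ltW // ln_sublinear // ltr0n.
have ln2 : ln 2 <= 1 :> R.
  by have := @le_ln1Dx R 1; rewrite -[1 + 1]/2%:R; apply; lra.
rewrite natrM !natrX lnM ?posrE ?exprn_gt0 ?ltr0n // !lnXn ?ltr0n //.
rewrite -addrA -natrD; apply: lerD.
  by rewrite -[leLHS]mulr_natr expr2 ler_pM2r ?ltr0n // ln_le.
by rewrite -[leRHS]mulr_natr -[leLHS]mulr_natr mul1r ler_piMl.
Qed.

Lemma exists_root k n : exists w, (w ^ k.+1 <= n < w.+1 ^ k.+1)%N.
Proof.
have ex0 : exists w, (w ^ k.+1 <= n)%N by exists 0%N; rewrite exp0n.
have bd w : (w ^ k.+1 <= n)%N -> (w <= n)%N.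
  by case: w => // w; apply: leq_trans; rewrite expnS leq_pmulr // expn_gt0.
case: (ex_maxnP ex0 bd) => w w_le w_max; exists w; rewrite w_le ltnNge /=.
by apply/negP => /w_max; rewrite ltnn.
Qed.

(** The sieve level is [z = w ^ 2], with [w] about [n ^ (1/10)]: then the error
    terms are [O (w ^ 8) = O (n / w ^ 2)], and [ln n <= 10 w].  The
    lower bounds on [Q] and [w] in terms of [e] keep the main term and the error
    term of the logarithm of the number of traces below half of the target
    each; the other two conditions make the sifted sets small enough for the
    greedy choice of moduli. *)
Lemma ln_diff_le (R : realType) (e : R) (n Q w : nat) :
  0 < e -> (0 < Q)%N -> 200 / e <= Q%:R -> (w ^ 10 <= n < w.+1 ^ 10)%N ->
  (4 * Q * Q.+1 <= w)%N -> 140 / e <= w%:R -> (160 * Q * Q.+1)%:R <= ln n%:R :> R ->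
  `|ln (N_surv n)%:R - ln (A_adm n)%:R| <= e * (n%:R / ln n%:R).
Proof.
move=> e_gt0 Q_gt0 Qe /andP[n_ge n_lt] Qw we ln_n.
have w_gt0 : (0 < w)%N by apply: leq_trans Qw; rewrite !muln_gt0 Q_gt0.
pose h := (n %/ Q)%N; pose z := (w ^ 2)%N.
have n_hQ : (n < h.+1 * Q)%N by rewrite -ltn_divLR.
have hQ_n : (h * Q <= n)%N by apply: leq_trunc_div.
have w_n : (w <= n)%N.
  by apply: leq_trans n_ge; rewrite -{1}[w]expn1 leq_pexp2l.
have h_gt0 : (0 < h)%N.
  rewrite divn_gt0 //; apply: leq_trans w_n; apply: leq_trans Qw; nia.
have n_2hQ : (n <= 2 * h * Q)%N by nia.
have z_gt0 : (0 < z)%N by rewrite expn_gt0 w_gt0.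
have z_le : (z <= 4 * h)%N.
  have : (w ^ 9 <= 2 * h)%N.
    rewrite -(leq_pmul2r w_gt0) -expnSr; apply: leq_trans n_ge _.
    by apply: leq_trans n_2hQ _; rewrite leq_mul2l; apply/orP; right; nia.
  have : (w ^ 2 <= w ^ 9)%N by rewrite leq_pexp2l.
  rewrite /z; lia.
have l_gt0 : 0 < ln n%:R :> R by apply: lt_le_trans ln_n; rewrite ltr0n !muln_gt0 Q_gt0.
have n_gt0 : (0 < n)%N by apply: leq_trans w_n.
have l_le : ln n%:R <= 10 * ln w.+1%:R :> R.
  rewrite [10 * _]mulr_natl -lnXn ?ltr0n // ler_ln ?posrE ?exprn_gt0 ?ltr0n //.
  by rewrite -natrX ler_nat ltnW.
have l_lz : ln n%:R <= 10 * ln z.+1%:R :> R.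
  apply: le_trans l_le _; rewrite ler_pM2l // ler_ln ?posrE ?ltr0n // ler_nat ltnS.
  by rewrite -{1}[w]expn1 leq_pexp2l.
have l_lw : ln n%:R <= 10 * w%:R :> R.
  apply: le_trans l_le _; rewrite ler_pM2l // -natr1 addrC.
  by apply: le_ln1Dx; apply: lt_le_trans (ler0n _ _); rewrite oppr_lt0.
set l := ln n%:R in l_gt0 l_le l_lz l_lw ln_n *.
have lz_gt0 : 0 < ln z.+1%:R :> R by lra.
have z4 : (z ^ 4)%:R <= n%:R / w%:R ^+ 2 :> R.
  rewrite ler_pdivlMr ?exprn_gt0 ?ltr0n // -natrX -natrM ler_nat.
  by rewrite /z -expnM -expnD.
pose bd (m : nat) : R := 2 * m%:R / ln z.+1%:R + (z ^ 4)%:R.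
have bd_ge0 m : 0 <= bd m.
  by apply: addr_ge0 => //; apply: divr_ge0; [exact: mulr_ge0 | exact: ltW].
have bd_le m : bd m <= 20 * m%:R / l + n%:R / w%:R ^+ 2.
  apply: lerD => //; rewrite ler_pdivrMr // mulrAC ler_pdivlMr //.
  rewrite (_ : 20 * _ * _ = 2 * m%:R * (10 * ln z.+1%:R)); last by ring.
  by apply: ler_wpM2l => //; exact: mulr_ge0.
have sift m c : (#|[set x : 'I_m | sifted c z x]| <= Num.truncn (bd m))%N.
  by rewrite truncn_ge_nat //; exact: card_sifted_le.
have tr_le m : (Num.truncn (bd m))%:R <= bd m by have /andP[] := truncn_itv (bd_ge0 m).
have u_le : (Num.truncn (bd n.+2) * Q + Num.truncn (bd n.+2) <= h)%N.
  rewrite -mulnSr; set u := Num.truncn _.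
  have n_hQR : n%:R <= 2 * h%:R * Q%:R :> R by rewrite -!natrM ler_nat.
  have QR : 1 <= Q%:R :> R by rewrite ler1n.
  have nR : 1 <= n%:R :> R by rewrite ler1n.
  pose q : R := Q%:R * Q.+1%:R.
  have q_ge : 1 <= q by rewrite /q -natrM ler1n muln_gt0 Q_gt0.
  have lq : 160 * q <= l by rewrite /q mulrA -!natrM.
  have wq : 4 * q <= w%:R by rewrite /q mulrA -!natrM ler_nat.
  have main_term : 20 * n.+2%:R / l * q <= 3 / 8 * n%:R.
    rewrite mulrAC ler_pdivrMr // -addn2 natrD.
    have : n%:R * (160 * q) <= n%:R * l by rewrite ler_wpM2l.
    nra.
  have error_term : n%:R / w%:R ^+ 2 * q <= 1 / 8 * n%:R.
    rewrite mulrAC ler_pdivrMr ?exprn_gt0 ?ltr0n // [1 / 8 * _]mulrC -mulrA ler_pM2l ?ltr0n //.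
    nra.
  have uq : u%:R * q <= (20 * n.+2%:R / l + n%:R / w%:R ^+ 2) * q.
    by rewrite ler_wpM2r ?(le_trans (tr_le _) (bd_le _)) // (le_trans ler01).
  rewrite mulrDl in uq.
  rewrite -(ler_nat R) natrM -(@ler_pM2r _ Q%:R) ?ltr0n // -mulrA [_ * Q%:R]mulrC -/q.
  lra.
have NA := @N_surv_le n h Q z _ _ h_gt0 z_le n_hQ u_le (sift n.+2) (sift _).
have AN := @A_adm_le n h Q z _ _ h_gt0 z_le n_hQ u_le (sift n.+2) (sift _).
apply: le_trans (ln_ratio_le R (N_surv_gt0 n) (A_adm_gt0 n) _ NA AN) _.
  by rewrite muln_gt0 !expn_gt0.
apply: le_trans (ln_trace_count_le R _ _) _.
apply: le_trans (lerD (lexx _) (tr_le _)) _.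
apply: le_trans (lerD (lexx _) (bd_le _)) _.
have hQR : h%:R * Q%:R <= n%:R :> R by rewrite -natrM ler_nat.
have hR : 1 <= h%:R :> R by rewrite ler1n.
have wR : 1 <= w%:R :> R by rewrite ler1n.
have eQ : 200 <= e * Q%:R by rewrite mulrC -ler_pdivrMr.
have ew : 140 <= e * w%:R by rewrite mulrC -ler_pdivrMr.
have main_term : 20 * (4 * h).+1%:R / l <= e / 2 * (n%:R / l).
  rewrite [leRHS]mulrA ler_pM2r ?invr_gt0 // -[(4 * h).+1%:R]natr1 natrM.
  have : h%:R * 200 <= h%:R * (e * Q%:R) by rewrite ler_wpM2l.
  have : e * (h%:R * Q%:R) <= e * n%:R by rewrite ler_pM2l.
  lra.
have error_term : 7 * (n%:R / w%:R ^+ 2) <= e / 2 * (n%:R / l).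
  have lw : 14 * l <= e * w%:R ^+ 2 by nra.
  rewrite [leLHS]mulrA ler_pdivrMr ?exprn_gt0 ?ltr0n //.
  rewrite (_ : e / 2 * _ * _ = e / 2 * n%:R * w%:R ^+ 2 / l); last by ring.
  rewrite ler_pdivlMr //.
  have : n%:R * (14 * l) <= n%:R * (e * w%:R ^+ 2) by rewrite ler_wpM2l.
  lra.
have z_term : z.+1%:R ^+ 2 + z.+1%:R <= 6 * (n%:R / w%:R ^+ 2) :> R.
  have zR : z.+1%:R <= 2 * w%:R ^+ 2 :> R by rewrite -[z.+1%:R]natr1 natrX; nra.
  have w4 : w%:R ^+ 4 <= n%:R / w%:R ^+ 2 :> R.
    rewrite ler_pdivlMr ?exprn_gt0 ?ltr0n // -exprD -natrX ler_nat.
    by apply: leq_trans n_ge; rewrite leq_pexp2l.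
  have w24 : w%:R ^+ 2 <= w%:R ^+ 4 :> R by rewrite ler_weXn2l.
  have : z.+1%:R ^+ 2 <= 4 * w%:R ^+ 4 :> R.
    rewrite (_ : 4 * _ = (2 * w%:R ^+ 2) ^+ 2); last by ring.
    by rewrite ler_pXn2r // nnegrE // mulr_ge0 // exprn_ge0.
  lra.
lra.
Qed.

Import numFieldNormedType.Exports.
Local Open Scope classical_set_scope.
Local Open Scope ring_scope.

Theorem theorem20 (R : realType) :
  (fun n : nat => ln (N_surv n)%:R : R) =
    (fun n : nat => ln (A_adm n)%:R : R) +o_ \oo
      (fun n : nat => n%:R / ln n%:R : R).
Proof.
apply/eqaddoP => e e_gt0.
pose Q := (Num.bound (200 / e)).+1.
have Qe : 200 / e <= Q%:R.
  by rewrite ltW // (lt_trans (archi_boundP _)) ?ltr_nat // divr_ge0 // ltW.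
pose w0 := (Num.bound (140 / e) + 4 * Q * Q.+1)%N.
have we : 140 / e <= w0%:R.
  apply: ltW; apply: lt_le_trans (archi_boundP _) _; first by rewrite divr_ge0 // ltW.
  by rewrite ler_nat leq_addr.
pose n0 := (w0 ^ 10 + Num.bound (expR (160 * Q * Q.+1)%:R : R))%N.
exists n0 => // n /= n0_n.
have [w /andP[w_le w_gt]] := exists_root 9 n.
have w0_w : (w0 <= w)%N.
  rewrite -ltnS -(@ltn_exp2r _ _ 10) //; apply: leq_ltn_trans w_gt.
  by apply: leq_trans n0_n; apply: leq_addr.
have w_gt0 : (0 < w)%N by apply: leq_trans w0_w; rewrite addn_gt0 !muln_gt0 orbT.
have ln_n : (160 * Q * Q.+1)%:R <= ln n%:R :> R.
  rewrite -[leLHS]expRK ler_ln ?posrE ?expR_gt0 //; last first.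
    by rewrite ltr0n; apply: leq_trans w_le; rewrite expn_gt0 w_gt0.
  apply: ltW; apply: lt_le_trans (archi_boundP (expR_ge0 _)) _.
  by rewrite ler_nat (leq_trans _ n0_n) // leq_addl.
apply: (@le_trans _ _ (e * (n%:R / ln n%:R))); last by rewrite ler_pM2l // ler_norm.
apply: (@ln_diff_le _ _ _ Q w) => //; first by rewrite w_le.
- by apply: leq_trans w0_w; apply: leq_addl.
- by apply: le_trans we _; rewrite ler_nat.
Qed.
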